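(* Let $\mathbb{F}$ be a field, let $k>2$ be an integer, and let $L_{2k-1}$ be the path graph with vertices $x_1,\ldots,x_{2k-1}$ and edges $\{x_1,x_2\},\{x_2,x_3\},\ldots,\{x_{2k-2},x_{2k-1}\}$. Then $\mathbb{F}[\Delta_k^t(L_{2k-1})]$ has a linear resolution and is Cohen-Macaulay.
   Context: A simplicial complex on a finite set $V$ is a collection of subsets of $V$ closed under taking subsets (an element of $V$ need not itself be a face). Its Stanley-Reisner ring over $\mathbb{F}$ is $\mathbb{F}[\Delta]=S/I_\Delta$, where $S$ is the polynomial ring over $\mathbb{F}$ with one variable for each $v\in V$ (including those $v$ that are not faces) and $I_\Delta$ is generated by the products of the variables over $F$, for all $F\subseteq V$ with $F\notin\Delta$. For a finite simple graph $G=(V,E)$ and a positive integer $k$, $\Delta_k^t(G)$ is the simplicial complex on $V$ whose facets are the complements $V\setminus M$ of the independent sets $M\subseteq V$ of size $k$ (independent: no two elements adjacent). For a homogeneous ideal $I\subseteq S$, $\beta_{i,j}=\dim_{\mathbb{F}}\mathrm{Tor}^S_i(S/I,\mathbb{F})_j$ are the graded Betti numbers of $S/I$. $S/I$ has an $s$-linear resolution if $I$ is generated in degree $s$ and $\beta_{i,j}=0$ whenever $i\ge1$ and $j\ne s+i-1$; it has a linear resolution if it has an $s$-linear resolution for some $s\ge 1$. *)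

(* Defs.v *)
From HB Require Import structures.
From mathcomp Require Import all_boot all_order all_algebra.
From mathcomp Require Import mpoly.

Set Implicit Arguments.
Unset Strict Implicit.
Unset Printing Implicit Defensive.

Import GRing.Theory.
Local Open Scope ring_scope.

(** * Graphs and simplicial complexes *)

Record simple_graph (V : finType) := SimpleGraph {
  adj :> rel V;
  adj_sym : ssrbool.symmetric adj;
  adj_irrefl : irreflexive adj
}.

Definition independent (V : finType) (G : simple_graph V) (M : {set V}) : bool :=
  [forall x in M, forall y in M, ~~ G x y].

(* The vertex x_i of the path is the ordinal i - 1. *)
Definition path_adj (n : nat) : rel 'I_n :=
  fun i j => (i.+1 == j :> nat) || (j.+1 == i :> nat).

Lemma path_adj_sym n : ssrbool.symmetric (@path_adj n).
Proof. by move=> i j; rewrite /path_adj orbC. Qed.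

Lemma path_adj_irrefl n : irreflexive (@path_adj n).
Proof. by move=> i; rewrite /path_adj orbb eqn_leq ltnn. Qed.

Definition path_graph (n : nat) : simple_graph 'I_n :=
  SimpleGraph (@path_adj_sym n) (@path_adj_irrefl n).

(* The points of V need not be faces, and a complex may have no face at all. *)
Record simplicial_complex (V : finType) := SimplicialComplex {
  faces :> {set {set V}};
  faces_closed : forall A B : {set V}, B \subset A -> A \in faces -> B \in faces
}.

Definition facet (V : finType) (D : simplicial_complex V) (A : {set V}) : bool :=
  maxset (fun B => B \in faces D) A.

Section TotalCutComplex.

Variables (V : finType) (k : nat) (G : simple_graph V).

Definition total_cut_faces : {set {set V}} :=
  [set A : {set V} |
    [exists M : {set V}, [&& independent G M, #|M| == k & A \subset ~: M]]].

Lemma total_cut_faces_closed (A B : {set V}) :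
  B \subset A -> A \in total_cut_faces -> B \in total_cut_faces.
Proof.
move=> sBA; rewrite !inE => /existsP[M /and3P[iM cM sAM]].
by apply/existsP; exists M; rewrite iM cM (subset_trans sBA).
Qed.

Definition total_cut_complex : simplicial_complex V :=
  SimplicialComplex total_cut_faces_closed.

Lemma facet_total_cut_complex (A : {set V}) :
  reflect (exists2 M : {set V}, independent G M /\ #|M| = k & A = ~: M)
          (facet total_cut_complex A).
Proof.
apply: (iffP maxsetP) => [[] | [M [iM cM] ->]].
  rewrite inE => /existsP[M /and3P[iM /eqP cM sAM]] maxA.
  exists M => //; apply/esym/maxA => //.
  by rewrite inE; apply/existsP; exists M; rewrite iM cM eqxx /=.
split=> [|B]; first by rewrite inE; apply/existsP; exists M; rewrite iM cM eqxx /=.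
rewrite inE => /existsP[N /and3P[_ /eqP cN sBN]] sMB.
have /eqP eMN : ~: M == ~: N.
  rewrite eqEcard (subset_trans sMB sBN) /=.
  by rewrite -(leq_add2l #|M|) cardsC cM -cN cardsC.
by apply/eqP; rewrite eqEsubset sMB andbT eMN.
Qed.

End TotalCutComplex.

(** * Ideals, Krull dimension and regular sequences *)

Section Ideals.

Variable R : comNzRingType.
Implicit Types (I J P : R -> Prop) (s : seq R).

Definition is_ideal J : Prop :=
  [/\ J 0, forall x y, J x -> J y -> J (x + y) & forall a x, J x -> J (a * x)].

Definition is_prime_ideal P : Prop :=
  [/\ is_ideal P, ~ P 1 & forall x y, P (x * y) -> P x \/ P y].

Definition ideal_gen (A : R -> Prop) : R -> Prop := fun p =>
  exists cs : seq (R * R),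
    {in cs, forall u, A u.2} /\ p = \sum_(u <- cs) u.1 * u.2.

(* A strict chain Q 0 < ... < Q d of primes of R containing I, that is, of
   primes of R/I. *)
Definition prime_chain I (d : nat) (Q : nat -> R -> Prop) : Prop :=
  (forall i, (i <= d)%N -> is_prime_ideal (Q i) /\ (forall x, I x -> Q i x)) /\
  (forall i, (i < d)%N ->
     (forall x, Q i x -> Q i.+1 x) /\ (exists x, Q i.+1 x /\ ~ Q i x)).

Definition krull_dim_quotient I (d : nat) : Prop :=
  (exists Q, prime_chain I d Q) /\
  (forall e Q, prime_chain I e Q -> (e <= d)%N).

Definition ideal_add_seq I s : R -> Prop := ideal_gen (fun p => I p \/ p \in s).

Definition regular_seq_quotient I s : Prop :=
  (forall i, (i < size s)%N -> forall a,
     ideal_add_seq I (take i s) (s`_i * a) -> ideal_add_seq I (take i s) a) /\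
  ~ ideal_add_seq I s 1.

End Ideals.

(** * Graded quotients of a polynomial ring *)

Section GradedQuotients.

Variables (F : fieldType) (n : nat).
Local Notation S := {mpoly F[n]}.
Implicit Types (I : S -> Prop) (s : seq S).

Definition stanley_reisner_ideal (D : simplicial_complex 'I_n) : S -> Prop :=
  ideal_gen (fun p => exists A : {set 'I_n}, A \notin faces D /\
                        p = \prod_(v in A) 'X_v).

Definition in_irrelevant_ideal (p : S) : bool := p@_0%MM == 0.

(* depth and dimension of the standard graded algebra S/I with respect to its
   irrelevant maximal ideal *)
Definition depth_quotient I (d : nat) : Prop :=
  (exists s, [/\ all in_irrelevant_ideal s, regular_seq_quotient I s
               & size s = d]) /\
  (forall s, all in_irrelevant_ideal s -> regular_seq_quotient I s ->
     (size s <= d)%N).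

Definition cohen_macaulay_quotient I : Prop :=
  exists d, depth_quotient I d /\ krull_dim_quotient I d.

(* A sequence of maps of finitely generated graded free modules
     ... -> C_2 -> C_1 -> C_0 -> S,   C_i = S^(fc_rank i),
   where the basis element a of C_i has degree [fc_deg i a].  Elements are row
   vectors, on which the maps act by right multiplication.  Nonzero homogeneous
   entries have the degree that makes every map homogeneous of degree 0.  S/I
   lives in nonnegative degrees, so nonnegative generator degrees suffice. *)
Record graded_free_seq := GradedFreeSeq {
  fc_rank : nat -> nat;
  fc_deg : forall i, 'I_(fc_rank i) -> nat;
  fc_diff : forall i, 'M[S]_(fc_rank i.+1, fc_rank i);
  fc_aug : 'cV[S]_(fc_rank 0);
  fc_diff_homog : forall i a b,
    {in msupp (fc_diff i a b),
       forall m, (mdeg m + fc_deg b)%N = fc_deg a};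
  fc_aug_homog : forall a,
    {in msupp (fc_aug a 0), forall m, mdeg m = fc_deg a}
}.

(* ... -> C_1 -> C_0 -> S/I -> 0 is exact. *)
Definition resolves (C : graded_free_seq) I : Prop :=
  [/\ exists v : 'rV_(fc_rank C 0), I (1 - (v *m fc_aug C) 0 0),
      forall v : 'rV_(fc_rank C 0),
        I ((v *m fc_aug C) 0 0) <-> exists w, v = w *m fc_diff C 0
    & forall i (v : 'rV_(fc_rank C i.+1)),
        v *m fc_diff C i = 0 <-> exists w, v = w *m fc_diff C i.+1].

Section TensorWithResidueField.

Variable C : graded_free_seq.

(* Since F = S/(X_0, ..., X_(n-1)), the complex C (x) F has the terms
   F^(fc_rank i), and its maps are the matrices of constant coefficients. *)
Definition residue_diff (i : nat) : 'M[F]_(fc_rank C i.+1, fc_rank C i) :=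
  map_mx (fun p : S => p@_0%MM) (fc_diff C i).

(* row space: the degree j component of C_i (x) F *)
Definition degree_part (i j : nat) : 'M[F]_(fc_rank C i) :=
  diag_mx (\row_a ((fc_deg a == j)%:R : F)).

Definition tor_cycles (i j : nat) : 'M[F]_(fc_rank C i) :=
  match i return 'M[F]_(fc_rank C i) with
  | 0 => degree_part 0 j
  | i'.+1 => (degree_part i'.+1 j :&: kermx (residue_diff i'))%MS
  end.

Definition tor_boundaries (i j : nat) : 'M[F]_(fc_rank C i.+1, fc_rank C i) :=
  degree_part i.+1 j *m residue_diff i.

Definition tor_dim (i j : nat) : nat :=
  (\rank (tor_cycles i j) - \rank (tor_boundaries i j))%N.

End TensorWithResidueField.

(* b = dim_F Tor_i^S(S/I, F)_j; Tor is computed from a graded free resolution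
   of S/I, and does not depend on which one is taken. *)
Definition graded_betti I (i j b : nat) : Prop :=
  exists C : graded_free_seq, resolves C I /\ tor_dim C i j = b.

Definition generated_in_degree I (d : nat) : Prop :=
  forall p, I p <-> ideal_gen (fun q => I q /\ q \is d.-homog) p.

Definition has_s_linear_resolution I (d : nat) : Prop :=
  generated_in_degree I d /\
  (forall i j, (1 <= i)%N -> j <> (d + i - 1)%N -> graded_betti I i j 0).

Definition has_linear_resolution I : Prop :=
  exists d, (1 <= d)%N /\ has_s_linear_resolution I d.

End GradedQuotients.

Arguments stanley_reisner_ideal F {n} D.

(* Main.v *)
From HB Require Import structures.
Require Import Defs.
From mathcomp Require Import all_boot all_order all_algebra.
From mathcomp Require Import mpoly zify.

Set Implicit Arguments.
Unset Strict Implicit.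
Unset Printing Implicit Defensive.

Import GRing.Theory.
Local Open Scope ring_scope.

(** The path on 2k-1 vertices x_1, ..., x_(2k-1) has exactly one independent
set of size k, the set of the x_i with i odd.  With the numbering from 0
that is used below, it consists of the even ordinals.  Indeed each of the maps i |-> floor(i/2)
and i |-> ceil(i/2) sends an independent set M injectively into {0, ..., k-1},
hence bijectively if #|M| = k; so both have the same sum over M, and as
floor(i/2) <= ceil(i/2) with equality only for even i, all elements of M are
even ([independent_path_unique]).  Therefore the complex has a single facet, and
its Stanley-Reisner ideal is generated by the k variables of that set
([stanley_reisner_var_ideal]).  It remains to see that an ideal I_A generated by
a set A of variables has a linear resolution and a Cohen-Macaulay quotient.

The ideal I_A is the kernel of the substitution that sends the variables of A to
0 and fixes the others.  So it is prime, and a variable outside A is a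
nonzerodivisor modulo I_A.  Adding the variables of A one at a time, and taking
each time the mapping cone of the multiplication by the new variable
([cone_resolves]), gives the Koszul complex, whose i-th module is generated in
degree i ([var_ideal_linear_resolution]).

Adding to A the variables outside A one at a time gives both a chain of primes
and a regular sequence of length d, the number of variables outside A.  The
bound that no such chain or sequence is longer is the same for both.  A strict
chain of primes and a regular sequence each give an increasing chain of proper
ideals J_0, ..., J_e and elements f_i of J_(i+1) that are nonzerodivisors modulo
J_i ([nzd_chain]).  Such f_i satisfy no nontrivial polynomial relation over F modulo J_0
([nzd_chain_independent]).  On the other hand the N^e products of the f_i with
exponents below N are, modulo I_A, combinations of only O(N^d) monomials, so
they are linearly dependent for large N as soon as e > d ([nzd_chain_size]). *)

(** * Ideals *)

Section IdealBasics.

Variable R : comNzRingType.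
Implicit Types (I J : R -> Prop) (x y a : R).

Lemma ideal0 I : is_ideal I -> I 0. Proof. by case. Qed.

Lemma idealD I : is_ideal I -> forall x y, I x -> I y -> I (x + y).
Proof. by case. Qed.

Lemma idealM I : is_ideal I -> forall a x, I x -> I (a * x).
Proof. by case. Qed.

Lemma idealN I : is_ideal I -> forall x, I x -> I (- x).
Proof. by move=> idI x Ix; rewrite -mulN1r; apply: idealM. Qed.

Lemma idealB I : is_ideal I -> forall x y, I x -> I y -> I (x - y).
Proof. by move=> idI x y Ix Iy; apply: idealD => //; apply: idealN. Qed.

Lemma ideal_gen_is_ideal (A : R -> Prop) : is_ideal (ideal_gen A).
Proof.
split.
- by exists [::]; rewrite big_nil.
- move=> x y [cs [csA ->]] [ds [dsA ->]]; exists (cs ++ ds).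
  by rewrite big_cat; split=> // u; rewrite mem_cat => /orP[/csA|/dsA].
- move=> a x [cs [csA ->]]; exists [seq (a * u.1, u.2) | u <- cs]; split.
    by move=> u /mapP[w /csA Aw ->].
  by rewrite big_map mulr_sumr; apply: eq_bigr => u _; rewrite mulrA.
Qed.

Lemma ideal_gen_mem (A : R -> Prop) x : A x -> ideal_gen A x.
Proof.
by exists [:: (1, x)]; rewrite big_seq1 mul1r; split=> // u; rewrite inE => /eqP->.
Qed.

Lemma ideal_gen_sub (A J : R -> Prop) :
  is_ideal J -> (forall x, A x -> J x) -> forall x, ideal_gen A x -> J x.
Proof.
move=> idJ AJ _ [cs [csA ->]]; rewrite big_seq.
elim/big_ind: _ => [|x y|u /csA /AJ]; [exact: ideal0 | exact: idealD |].
exact: idealM.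
Qed.

Lemma principal_is_ideal x : is_ideal (fun p => exists a, p = a * x).
Proof.
split=> [|_ _ [a ->] [b ->]|c _ [a ->]].
- by exists 0; rewrite mul0r.
- by exists (a + b); rewrite mulrDl.
- by exists (c * a); rewrite mulrA.
Qed.

End IdealBasics.

(** * Ideals generated by variables *)

Section VariableIdeals.

Variables (F : fieldType) (n : nat).
Local Notation S := {mpoly F[n]}.
Implicit Types (A : {set 'I_n}) (p q : S) (m : 'X_{1..n}).

(** The retraction of S onto the polynomial ring in the variables outside A;
its kernel is the ideal generated by the variables of A. *)
Definition kill_vars A p : S :=
  p \mPo [tuple (if i \in A then 0 else 'X_i : S) | i < n].

Lemma kill_vars_zmod A : zmod_morphism (kill_vars A).
Proof. by move=> p q; rewrite /kill_vars raddfB. Qed.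
Lemma kill_vars_monoid A : monoid_morphism (kill_vars A).
Proof. by split=> [|p q]; rewrite /kill_vars ?rmorph1 ?rmorphM. Qed.
Lemma kill_vars_scalable A : scalable (kill_vars A).
Proof. by move=> c p; rewrite /kill_vars linearZ. Qed.
HB.instance Definition _ A := GRing.isZmodMorphism.Build S S (kill_vars A) (kill_vars_zmod A).
HB.instance Definition _ A := GRing.isMonoidMorphism.Build S S (kill_vars A) (kill_vars_monoid A).
HB.instance Definition _ A := GRing.isScalable.Build F S S _ (kill_vars A) (kill_vars_scalable A).

Lemma kill_varsXU A v : kill_vars A 'X_v = if v \in A then 0 else 'X_v.
Proof. by rewrite /kill_vars comp_mpolyXU -tnth_nth tnth_mktuple. Qed.

Lemma kill_varsX A m :
  kill_vars A 'X_[m] = if [forall u in A, m u == 0] then 'X_[m] else 0.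
Proof.
rewrite mpolyXE_id rmorph_prod /=.
case: ifPn => [/forall_inP mA | /forall_inPn[u uA mu]].
  apply: eq_bigr => i _; rewrite rmorphXn /= kill_varsXU.
  by case: ifP => // /mA /eqP->.
by rewrite (bigD1 u) //= rmorphXn /= kill_varsXU uA expr0n (negbTE mu) mul0r.
Qed.

Lemma mpolyX_div m u : m u != 0 -> 'X_[m] = 'X_[m - U_(u)] * 'X_u :> S.
Proof. by move=> mu; rewrite -mpolyXD submK // lep1mP. Qed.

(** It suffices to look at monomials: one that meets A is killed and is a
multiple of a variable of A, any other one is fixed. *)
Lemma sub_kill_vars A (J : S -> Prop) :
    is_ideal J -> {in A, forall u, J 'X_u} -> forall p, J (p - kill_vars A p).
Proof.
move=> idJ JA; elim/mpolyind => [|c m p _ _ IHp].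
  by rewrite raddf0 subr0; apply: ideal0.
rewrite raddfD /= linearZ /= kill_varsX opprD addrACA; apply: (idealD idJ) => //.
case: ifPn => [_|/forall_inPn[u uA mu]]; first by rewrite subrr; apply: ideal0.
rewrite scaler0 subr0 -mul_mpolyC (mpolyX_div mu).
by do 2!apply: (idealM idJ); apply: JA.
Qed.

Lemma kill_vars_setU1 A v p : kill_vars (v |: A) p = kill_vars A (kill_vars [set v] p).
Proof.
elim/mpolyind: p => [|c m p _ _ IHp]; first by rewrite !raddf0.
rewrite !raddfD /= !linearZ /= IHp; congr (_ *: _ + _).
rewrite [kill_vars [set v] _]kill_varsX; case: ifPn => [/forall_inP mv | /forall_inPn[u]].
  rewrite !kill_varsX; congr (if _ then _ else _).
  apply/forall_inP/forall_inP=> mA u uA; first by apply: mA; rewrite inE uA orbT.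
  by case/setU1P: uA => [->|/mA //]; apply: mv; rewrite inE.
rewrite inE => /eqP-> mv; rewrite raddf0 kill_varsX ifN //.
by apply/forall_inPn; exists v; rewrite // setU11.
Qed.

(** The ideal generated by the variables of A, as a kernel: this makes primality
immediate, and [var_ideal_sub] recovers the description by generators. *)
Definition var_ideal A p : Prop := kill_vars A p = 0.

Lemma var_ideal_is_ideal A : is_ideal (var_ideal A).
Proof.
split=> [|p q|a p]; rewrite /var_ideal; first exact: raddf0.
  by rewrite raddfD /= => -> ->; rewrite addr0.
by rewrite rmorphM /= => ->; rewrite mulr0.
Qed.

Lemma var_ideal_var A u : u \in A -> var_ideal A 'X_u.
Proof. by rewrite /var_ideal kill_varsXU => ->. Qed.

Lemma var_ideal_prime A : is_prime_ideal (var_ideal A).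
Proof.
split; first exact: var_ideal_is_ideal.
  by rewrite /var_ideal rmorph1; apply/eqP/oner_neq0.
move=> p q; rewrite /var_ideal rmorphM /= => /eqP.
by rewrite mulf_eq0 => /orP[]/eqP; [left|right].
Qed.

Lemma var_notin_var_ideal A v : v \notin A -> ~ var_ideal A 'X_v.
Proof.
rewrite /var_ideal kill_varsXU => /negbTE-> /eqP/negP[].
by rewrite -msupp_eq0 msuppX.
Qed.

Lemma var_ideal_nzd A v p : v \notin A -> var_ideal A ('X_v * p) -> var_ideal A p.
Proof.
by move=> vA; have [_ _ prA] := var_ideal_prime A; case/prA => // /(var_notin_var_ideal vA).
Qed.

(** An element p of the kernel equals p - kill_vars A p, which lies in every
ideal containing the variables of A. *)
Lemma var_ideal_sub A (J : S -> Prop) :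
  is_ideal J -> {in A, forall u, J 'X_u} -> forall p, var_ideal A p -> J p.
Proof.
by move=> idJ JA p pA; rewrite -[p]subr0 -pA; apply: sub_kill_vars.
Qed.

Lemma var_ideal_setU1 A v p :
  var_ideal (v |: A) p <-> exists a, var_ideal A (p - a * 'X_v).
Proof.
split=> [pvA | [a paA]].
  have [a def_p] : exists a, p - kill_vars [set v] p = a * 'X_v.
    apply: (@sub_kill_vars [set v] _ (principal_is_ideal 'X_v)) => u.
    by rewrite inE => /eqP->; exists 1; rewrite mul1r.
  by exists a; rewrite -def_p subKr /var_ideal -kill_vars_setU1.
have idvA := var_ideal_is_ideal (v |: A).
have sA q : var_ideal A q -> var_ideal (v |: A) q.
  by apply: var_ideal_sub => // u uA; apply: var_ideal_var; rewrite inE uA orbT.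
rewrite -[p](subrK (a * 'X_v)); apply: idealD => //; first exact: sA.
by apply: idealM => //; apply: var_ideal_var; rewrite setU11.
Qed.

Lemma var_idealS A (B : {set 'I_n}) p : A \subset B -> var_ideal A p -> var_ideal B p.
Proof.
move=> sAB; apply: var_ideal_sub; first exact: var_ideal_is_ideal.
by move=> u /(subsetP sAB)/var_ideal_var.
Qed.

End VariableIdeals.

(** * The mapping cone of a nonzerodivisor *)

Section Cone.

Variables (F : fieldType) (n : nat).
Local Notation S := {mpoly F[n]}.
Variables (C : graded_free_seq F n) (x : S) (e : nat).
Hypothesis xe : x \is e.-homog.

(** The mapping cone of the multiplication by x on C.  The augmentation to S/I
is not a term of C, so the copy of C that is shifted by one starts in
position 1. *)
Definition cone_rank (i : nat) : nat :=
  if i is j.+1 then (fc_rank C j.+1 + fc_rank C j)%N else fc_rank C 0.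

Definition cone_deg (i : nat) : 'I_(cone_rank i) -> nat :=
  match i return 'I_(cone_rank i) -> nat with
  | 0 => @fc_deg _ _ C 0
  | j.+1 => fun a => match split a with
                     | inl b => fc_deg b
                     | inr b => (fc_deg b + e)%N
                     end
  end.

Definition cone_diff (i : nat) : 'M[S]_(cone_rank i.+1, cone_rank i) :=
  match i return 'M[S]_(cone_rank i.+1, cone_rank i) with
  | 0 => col_mx (fc_diff C 0) x%:M
  | j.+1 => block_mx (fc_diff C j.+1) 0 x%:M (- fc_diff C j)
  end.

Lemma scalar_mx_homog r (deg : 'I_r -> nat) (a b : 'I_r) :
  {in msupp ((x%:M : 'M[S]_r) a b), forall m, (mdeg m + deg b = deg a + e)%N}.
Proof.
move=> m; rewrite mxE; case: eqP => [->|_]; last by rewrite msupp0.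
by rewrite mulr1n => /(dhomogP _ _ _ xe) ->; rewrite addnC.
Qed.

Lemma cone_diff_homog i (a : 'I_(cone_rank i.+1)) (b : 'I_(cone_rank i)) :
  {in msupp (cone_diff i a b), forall m, (mdeg m + cone_deg b)%N = cone_deg a}.
Proof.
case: i a b => [|i] a b m /=.
  rewrite mxE; case: splitP => a' _; first exact: fc_diff_homog.
  exact: scalar_mx_homog.
rewrite /block_mx mxE; case: splitP => a' _; rewrite mxE; case: splitP => b' _.
- exact: fc_diff_homog.
- by rewrite mxE msupp0.
- exact: scalar_mx_homog.
- rewrite mxE (perm_mem (msuppN _)) addnA => /fc_diff_homog-> //.
Qed.

Definition cone : graded_free_seq F n :=
  GradedFreeSeq cone_diff_homog (@fc_aug_homog _ _ C).

Fact scalemxE r s c (A : 'M[S]_(r, s)) i j : (c *: A) i j = c * A i j.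
Proof. exact: mxE. Qed.
Fact addmxE r s (A B : 'M[S]_(r, s)) i j : (A + B) i j = A i j + B i j.
Proof. exact: mxE. Qed.
Fact oppmxE r s (A : 'M[S]_(r, s)) i j : (- A) i j = - A i j.
Proof. exact: mxE. Qed.

(** The usual long exact sequence of the cone, on elements: a cycle (u, w) has w
in the image, w = t d, because w is a cycle of C, or, if w has degree 0 in C,
because x w maps into I, hence so does w; then u + x t is a cycle of C, hence
u + x t = s d, and (u, w) is the boundary of (s, - t). *)
Lemma cone_resolves (I J : S -> Prop) :
    is_ideal I -> (forall a, I (x * a) -> I a) ->
    (forall p, J p <-> exists a, I (p - a * x)) ->
  resolves C I -> resolves cone J.
Proof.
move=> idI nzd_x defJ [[v0 v0P] ex0 exS].
have IJ p : I p -> J p by move=> Ip; apply/defJ; exists 0; rewrite mul0r subr0.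
have matE := (@addmxE, @oppmxE, @scalemxE).
have I_im (w : 'rV_(fc_rank C 1)) : I ((w *m fc_diff C 0 *m fc_aug C) 0 0).
  by apply/ex0; exists w.
split; first by exists v0; apply: IJ.
- move=> v; split=> [/defJ[a Ia] | [w ->]].
    (* As v0 maps to 1 modulo I, v - (a x) v0 maps to I, so it is a boundary. *)
    have /ex0[w def_w] : I (((v - (a * x) *: v0) *m fc_aug C) 0 0).
      rewrite mulmxBl -scalemxAl !matE.
      set p := (v *m _) 0 0 in Ia *; set q := (v0 *m _) 0 0 in v0P *.
      have -> : p - a * x * q = (p - a * x) + a * x * (1 - q).
        by rewrite mulrBr mulr1 addrA subrK.
      by apply: idealD => //; apply: idealM.
    exists (row_mx w (a *: v0)); rewrite /= mul_row_col -def_w mul_mx_scalar.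
    by rewrite scalerA [x * a]mulrC subrK.
  rewrite -[w]hsubmxK /= mul_row_col mul_mx_scalar mulmxDl -scalemxAl.
  apply/defJ; exists ((rsubmx w *m fc_aug C) 0 0).
  by rewrite !matE [x * _]mulrC addrK.
case=> [|i] v; rewrite -[v]hsubmxK; move: (lsubmx v) (rsubmx v) => u w {v}.
- split=> [|[z ->]].
    rewrite /= mul_row_col mul_mx_scalar => uw0.
    have /ex0[t def_w] : I ((w *m fc_aug C) 0 0).
      apply: nzd_x; rewrite -matE scalemxAl -[x *: w](addKr (u *m fc_diff C 0)).
      by rewrite uw0 addr0 mulNmx matE; apply: idealN.
    have /exS[s def_s] : (u + x *: t) *m fc_diff C 0 = 0.
      by rewrite mulmxDl -scalemxAl -def_w.
    exists (row_mx s (- t)); rewrite /= mul_row_block mulmx0 add0r.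
    by rewrite mul_mx_scalar scalerN mulNmx mulmxN opprK -def_w -def_s addrK.
  rewrite -[z]hsubmxK /= mul_row_block mul_row_col mulmx0 add0r !mul_mx_scalar.
  have dd0 : lsubmx z *m fc_diff C 1 *m fc_diff C 0 = 0 by apply/exS; eexists.
  by rewrite mulmxDl dd0 add0r mulmxN -scalemxAl scalerN subrr.
split=> [|[z ->]].
  rewrite /= mul_row_block mulmx0 add0r mulmxN mul_mx_scalar.
  move/eqP; rewrite row_mx_eq0 oppr_eq0 => /andP[/eqP uw0 /eqP/exS[t def_w]].
  have /exS[s def_s] : (u + x *: t) *m fc_diff C i.+1 = 0.
    by rewrite mulmxDl -scalemxAl -def_w.
  exists (row_mx s (- t)); rewrite /= mul_row_block mulmx0 add0r.
  by rewrite mul_mx_scalar scalerN mulNmx mulmxN opprK -def_w -def_s addrK.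
rewrite -[z]hsubmxK /= !mul_row_block !mulmx0 !add0r !mul_mx_scalar.
have dd0 j (y : 'rV_(fc_rank C j.+2)) : y *m fc_diff C j.+1 *m fc_diff C j = 0.
  by apply/exS; eexists.
rewrite mulmxDl dd0 add0r !mulmxN mulNmx dd0 oppr0 -scalemxAl scalerN subrr.
by rewrite oppr0 row_mx0.
Qed.

End Cone.

(** * Linear resolutions *)

Section LinearResolution.

Variables (F : fieldType) (n : nat).
Local Notation S := {mpoly F[n]}.
Implicit Types (A : {set 'I_n}) (C : graded_free_seq F n) (I : S -> Prop).

(** S is itself free: the resolution of S modulo the zero ideal. *)
Definition trivial_rank (i : nat) : nat := if i is 0 then 1 else 0.

Fact trivial_diff_homog i (a : 'I_(trivial_rank i.+1)) (b : 'I_(trivial_rank i)) :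
  {in msupp ((0 : 'M[S]_(trivial_rank i.+1, trivial_rank i)) a b),
     forall m, (mdeg m + 0)%N = 0%N}.
Proof. by case: a. Qed.

Fact trivial_aug_homog (a : 'I_(trivial_rank 0)) :
  {in msupp ((const_mx 1 : 'cV[S]_(trivial_rank 0)) a 0), forall m, mdeg m = 0%N}.
Proof. by move=> m; rewrite mxE msupp1 inE => /eqP->; rewrite mdeg0. Qed.

Definition trivial_resolution : graded_free_seq F n :=
  @GradedFreeSeq F n trivial_rank (fun _ _ => 0%N) (fun _ => 0) (const_mx 1)
    trivial_diff_homog trivial_aug_homog.

Lemma trivial_resolves : resolves trivial_resolution (@var_ideal F n set0).
Proof.
have var0 p : @var_ideal F n set0 p -> p = 0.
  apply: (@var_ideal_sub _ _ _ (eq^~ 0)) => [|u]; last by rewrite inE.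
  by split=> [|x y -> ->|a x ->]; rewrite ?addr0 ?mulr0.
have z0 : @var_ideal F n set0 0 by apply: ideal0; apply: var_ideal_is_ideal.
have augE (v : 'rV[S]_1) : (v *m const_mx 1 : 'M_1) 0 0 = v 0 0.
  by rewrite mxE big_ord1 mxE mulr1.
split.
- by exists 1; rewrite /= augE mxE subrr.
- move=> v /=; split=> [/var0|[w ->]]; last first.
    by rewrite mulmx0 mul0mx mxE.
  rewrite augE => v0; exists 0; rewrite mulmx0; apply/rowP=> j.
  by rewrite ord1 v0 mxE.
- move=> i v /=; split=> _; last by rewrite mulmx0.
  by exists 0; apply/rowP; case.
Qed.

(** Linearity for an ideal generated in degree 1: S/I is then resolved with
the i-th module generated in degree 1 + i - 1 = i, also for i = 0. *)
Definition linear_from_0 C : Prop := forall i (a : 'I_(fc_rank C i)), fc_deg a = i.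

Lemma var_ideal_linear_resolution A :
  exists C, resolves C (@var_ideal F n A) /\ linear_from_0 C.
Proof.
rewrite -[A]set_enum; elim: (enum A) => [|v s [C [resC linC]]].
  rewrite (_ : [set x in [::]] = set0); last by apply/setP=> u; rewrite !inE.
  exists trivial_resolution; split; first exact: trivial_resolves.
  by case=> [|i] [].
rewrite set_cons; have [vs|vs] := boolP (v \in [set:: s]).
  by exists C; rewrite (setUidPr _) // sub1set.
have xv : ('X_v : S) \is 1.-homog by rewrite dhomogX /= mdeg1.
exists (cone C xv); split.
  apply: (@cone_resolves _ _ _ _ _ xv _ _ _ _ _ resC) => [|p|p].
  - exact: var_ideal_is_ideal.
  - exact: var_ideal_nzd.
  - exact: var_ideal_setU1.
case=> [|i] /= a; first exact: linC.
by case: splitP => b _; rewrite linC // addn1.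
Qed.

(** The complex C (x) F has nothing in bidegree (i, j) when j <> i. *)
Lemma linear_tor_dim C i j : linear_from_0 C -> j <> i -> tor_dim C i j = 0%N.
Proof.
move=> linC /eqP neq_ji.
have deg0 : degree_part C i j = 0.
  rewrite /degree_part (_ : \row_a _ = 0) ?raddf0 //.
  by apply/rowP=> a; rewrite !mxE linC eq_sym (negbTE neq_ji).
suff cyc0 : tor_cycles C i j = 0 by rewrite /tor_dim cyc0 mxrank0.
case: i deg0 {neq_ji} => [|i] //= ->.
exact: cap0mx.
Qed.

Lemma var_ideal_has_linear_resolution I A :
  (forall p, I p <-> var_ideal A p) -> has_linear_resolution I.
Proof.
move=> defI; have [C [resC linC]] := var_ideal_linear_resolution A.
exists 1%N; split=> //; split=> [p|i j i_gt0 neq_ji]; last first.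
  exists C; split; last by apply: linear_tor_dim; rewrite // addKn in neq_ji *.
  have [[v vP] ex0 exS] := resC; split=> // [|w]; first by exists v; apply/defI.
  by rewrite defI.
split=> [/defI|].
  apply: var_ideal_sub => [|u uA]; first exact: ideal_gen_is_ideal.
  apply: ideal_gen_mem; split; first by apply/defI/var_ideal_var.
  by rewrite dhomogX /= mdeg1.
move=> genp; apply/defI; move: p genp; apply: ideal_gen_sub.
  exact: var_ideal_is_ideal.
by move=> q [/defI].
Qed.

End LinearResolution.

(** * Chains of ideals *)

Section NzdChain.

Variable R : comNzRingType.
Implicit Types (J : nat -> R -> Prop) (fs : seq R).

(** The common shadow of strict chains of primes and of regular sequences: an
increasing chain of proper ideals whose i-th step contains a nonzerodivisor
modulo J i. *)
Definition nzd_chain J fs : Prop :=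
  [/\ forall i, (i <= size fs)%N -> is_ideal (J i),
      ~ J (size fs) 1
    & forall i, (i < size fs)%N ->
        [/\ forall x, J i x -> J i.+1 x, J i.+1 fs`_i
          & forall a, J i (fs`_i * a) -> J i a]].

Lemma nzd_chain_behead J f fs :
  nzd_chain J (f :: fs) -> nzd_chain (fun i => J i.+1) fs.
Proof. by case=> idJ J1 chJ; split=> // i lt_i; [apply: idJ | apply: chJ]. Qed.

(** Take f_i in Q (i+1) but not in Q i: as Q i is prime, f_i is a nonzerodivisor
modulo Q i. *)
Lemma prime_chain_nzd_chain (I : R -> Prop) d Q :
  prime_chain I d Q -> exists2 fs, size fs = d & nzd_chain Q fs.
Proof.
case=> prQ.
elim: d Q prQ => [|d IHd] Q prQ incQ.
  exists [::] => //; have [[idQ Q1 _] _] := prQ 0%N isT.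
  by split=> // i; rewrite leqn0 => /eqP->.
have [|i lt_i|fs sz_fs [idJ J1 chJ]] := IHd (fun i => Q i.+1).
- by move=> i; apply: (prQ i.+1).
- exact: (incQ i.+1).
have [sub01 [f [Q1f Q0f]]] := incQ 0%N isT.
exists (f :: fs); rewrite /= ?sz_fs //; split=> [[|i] le_i||[|i] lt_i] //=.
- by have [[]] := prQ 0%N isT.
- exact: idJ.
- split=> // a Qfa; have [[_ _ pr] _] := prQ 0%N isT.
  by case/pr: Qfa.
exact: chJ.
Qed.

Lemma ideal_add_seq_mem (I : R -> Prop) s x : x \in s -> ideal_add_seq I s x.
Proof. by move=> xs; apply: ideal_gen_mem; right. Qed.

Lemma regular_seq_nzd_chain (I : R -> Prop) s :
  regular_seq_quotient I s ->
  nzd_chain (fun i => ideal_add_seq I (take i s)) s.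
Proof.
case=> regs s1; split=> [i _||i lt_i]; first exact: ideal_gen_is_ideal.
  by rewrite take_size.
rewrite (take_nth 0 lt_i); split=> [x||]; last exact: regs.
  apply: ideal_gen_sub => [|y [Iy|ys]]; first exact: ideal_gen_is_ideal.
    by apply: ideal_gen_mem; left.
  by apply: ideal_add_seq_mem; rewrite mem_rcons inE ys orbT.
by apply: ideal_add_seq_mem; rewrite mem_rcons inE eqxx.
Qed.

End NzdChain.

(** * Independence *)

Definition power_prod (R : comNzRingType) (fs : seq R) (t : seq nat) : R :=
  \prod_(u <- zip fs t) u.1 ^+ u.2.

Lemma sum_tuple_cons (R : nmodType) (T : finType) e (G : e.+1.-tuple T -> R) :
  \sum_t G t = \sum_j \sum_(t : e.-tuple T) G [tuple of j :: t].
Proof.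
rewrite pair_big /= (reindex (fun p : T * e.-tuple T => [tuple of p.1 :: p.2])) //=.
exists (fun t : e.+1.-tuple T => (thead t, [tuple of behead t])) => [[j t] _ | t _] /=.
  by congr pair; apply/val_inj.
by case/tupleP: t => j t; apply/val_inj.
Qed.

Section Independence.

Variables (F : fieldType) (n : nat).
Local Notation S := {mpoly F[n]}.

(** By induction on e.  Write a relation modulo J_0 as the sum of the f^j g_j,
where f is the first element and g_j involves only the others.  If all
coefficients in g_0, ..., g_(j-1) vanish, then f^j can be cancelled, so that
g_j + f (...) lies in J_0; as f lies in J_1, so does g_j, and its coefficients
vanish by induction, applied to the chain that starts at J_1. *)
Lemma nzd_chain_independent N e (J : nat -> S -> Prop) (fs : seq S)
    (c : e.-tuple 'I_N -> F) :
    size fs = e -> nzd_chain J fs ->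
    J 0%N (\sum_t c t *: power_prod fs (map val t)) ->
  forall t, c t = 0.
Proof.
elim: e J fs c => [|e IHe] J [|f fs] //= c => [_ | [sz_fs]] chJ.
  have [idJ J1 _] := chJ; have idJ0 := idJ 0%N isT.
  rewrite (big_pred1 [tuple]) => [Jc t|t]; last by rewrite [t]tuple0 /= eqxx.
  rewrite [t]tuple0; apply/eqP/negPn/negP=> c_neq0; apply: J1.
  have := idealM idJ0 (c [tuple])^-1%:MP Jc.
  by rewrite mul_mpolyC /power_prod big_nil scalerA mulVf // scale1r.
have [idJ _ /(_ 0%N isT) [J01 J1f nzd_f]] := chJ.
have idJ0 := idJ 0%N isT; have idJ1 := idJ 1%N isT.
pose g j := \sum_(t : e.-tuple 'I_N)
  c [tuple of j :: t] *: power_prod fs (map val t).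
have -> : \sum_t c t *: power_prod (f :: fs) (map val t)
    = \sum_(j < N) f ^+ j * g j.
  rewrite sum_tuple_cons; apply: eq_bigr => j _; rewrite mulr_sumr.
  by apply: eq_bigr => t _; rewrite /power_prod /= big_cons -scalerAr.
move=> Jsum.
suff c0 (j : 'I_N) : forall t : e.-tuple 'I_N, c [tuple of j :: t] = 0.
  by move=> t; rewrite (tuple_eta t); apply: c0.
have [m lt_jm] := ubnP j; elim: m j lt_jm => // m IHm j /ltnSE le_jm.
apply: (IHe (fun i => J i.+1) fs) => //; first exact: nzd_chain_behead chJ.
rewrite -/(g j) /=.
have nzd_fX k a : J 0%N (f ^+ k * a) -> J 0%N a.
  by elim: k => [|k IHk]; rewrite ?mul1r // exprS -mulrA => /nzd_f.
have : J 0%N (\sum_(i < N | (j <= i)%N) f ^+ (i - j) * g i).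
  apply: (nzd_fX j); rewrite mulr_sumr.
  rewrite (eq_bigr (fun i : 'I_N => f ^+ i * g i)) => [|i le_ji]; last first.
    by rewrite mulrA -exprD subnKC.
  move: Jsum; rewrite (bigID (fun i : 'I_N => (j <= i)%N)) /=.
  rewrite [X in _ + X]big1 ?addr0 // => i; rewrite -ltnNge => lt_ij.
  rewrite /g big1 ?mulr0 // => t _; rewrite IHm ?scale0r //.
  exact: leq_trans lt_ij _.
rewrite (bigD1 j) //= subnn mul1r; set r := \sum_(i | _) _ => /J01 Jgr.
rewrite -[g j](addrK r); apply: (idealB idJ1) => //.
apply: big_ind => [|x y|i /andP[le_ji neq_ij]]; [exact: ideal0 | exact: idealD |].
have lt_ji : (j < i)%N by rewrite ltn_neqAle le_ji andbT eq_sym.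
by rewrite -(subnSK lt_ji) exprS -mulrA mulrC; apply: idealM.
Qed.

(** * Counting monomials *)

(** The matrix of coefficients has more rows than columns. *)
Lemma more_polys_than_monomials (T : finType) (g : T -> S) (B : seq 'X_{1..n}) :
    (forall t, {subset msupp (g t) <= B}) -> (size B < #|T|)%N ->
  exists2 c : T -> F, \sum_t c t *: g t = 0 & exists t, c t != 0.
Proof.
move=> suppB ltBT.
pose M : 'M[F]_(#|T|, size B) := \matrix_(i, j) (g (enum_val i))@_(nth 0%MM B j).
have kerM : kermx M != 0.
  rewrite kermx_eq0 /row_free neq_ltn.
  by rewrite (leq_ltn_trans (rank_leq_col M) ltBT).
have /rowV0Pn[w /sub_kermxP wM0 w_neq0] := kerM.
exists (fun t => w 0 (enum_rank t)); last first.
  by have [j wj] := rV0Pn _ w_neq0; exists (enum_val j); rewrite enum_valK.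
apply/mpolyP=> m; rewrite mcoeff0 raddf_sum /=.
have [mB|mB] := boolP (m \in B); last first.
  rewrite big1 // => t _; rewrite mcoeffZ memN_msupp_eq0 ?mulr0 //.
  by apply: contra mB; apply: suppB.
have lt_m : (index m B < size B)%N by rewrite index_mem.
transitivity ((w *m M) 0 (Ordinal lt_m)); last by rewrite wM0 mxE.
rewrite mxE (reindex _ (onW_bij _ (enum_val_bij T))) /=.
by apply: eq_bigr => i _; rewrite mcoeffZ enum_valK mxE /= nth_index.
Qed.

(** Bounding each exponent, rather than the total degree, keeps the count of
monomials a plain power. *)
Definition box (A : {set 'I_n}) (D : nat) (p : S) : Prop :=
  {in msupp p, forall m : 'X_{1..n}, forall i, (m i <= if i \in A then 0 else D)%N}.

Definition box_monomials (A : {set 'I_n}) (D : nat) : seq 'X_{1..n} :=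
  [seq [multinom (f i : nat) | i < n]
     | f : {ffun 'I_n -> 'I_D.+1} <- enum (pffun_on (ord0 : 'I_D.+1) (~: A) predT)].

Lemma size_box_monomials A D : size (box_monomials A D) = (D.+1 ^ #|~: A|)%N.
Proof. by rewrite size_map -cardE card_pffun_on card_ord. Qed.

Lemma box_msupp A D p : box A D p -> {subset msupp p <= box_monomials A D}.
Proof.
move=> pAD m /pAD mAD.
apply/mapP; exists [ffun i => inord (m i) : 'I_D.+1]; last first.
  apply/mnmP=> i; rewrite mnmE ffunE inordK // ltnS (leq_trans (mAD i)) //.
  by case: ifP.
rewrite mem_enum; apply/pffun_onP; split=> [|i] //; apply/subsetP=> i.
rewrite !inE ffunE; apply: contraNN => iA.
by have := mAD i; rewrite iA leqn0 => /eqP->; apply/eqP/val_inj; rewrite /= inordK.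
Qed.

Lemma boxS A D E p : (D <= E)%N -> box A D p -> box A E p.
Proof.
move=> leDE pAD m /pAD mAD i; apply: leq_trans (mAD i) _.
by case: ifP.
Qed.

Lemma box1 A D : box A D 1.
Proof. by move=> m; rewrite msupp1 inE => /eqP-> i; rewrite mnm0E. Qed.

Lemma boxM A D E p q : box A D p -> box A E q -> box A (D + E) (p * q).
Proof.
move=> pAD qAE m /msuppM_le/allpairsP[[m1 m2] /= [/pAD m1AD /qAE m2AE ->]] i.
rewrite mnmDE; apply: leq_trans (leq_add (m1AD i) (m2AE i)) _.
by case: ifP.
Qed.

Lemma boxX A D p k : box A D p -> box A (k * D) (p ^+ k).
Proof.
move=> pAD; elim: k => [|k IHk]; first exact: box1.
by rewrite exprS mulSn; apply: boxM.
Qed.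

Lemma box_kill_vars A p : exists D, box A D (kill_vars A p).
Proof.
elim/mpolyind: p => [|c m p _ _ [D pAD]].
  by exists 0%N => m; rewrite raddf0 msupp0.
exists (maxn (mdeg m) D); rewrite raddfD /= linearZ /= kill_varsX.
move=> m' /msuppD_le; rewrite mem_cat => /orP[/msuppZ_le|]; last first.
  by apply: boxS pAD _; rewrite leq_maxr.
case: ifP => [/forall_inP mA|_]; last by rewrite msupp0.
rewrite msuppX inE => /eqP-> i; case: ifP => [/mA/eqP-> // | _].
by rewrite leq_max mdegE (bigD1 i) //= leq_addr.
Qed.

Lemma box_kill_vars_seq A (fs : seq S) : exists D, {in fs, forall f, box A D (kill_vars A f)}.
Proof.
elim: fs => [|f fs [D fsD]]; first by exists 0%N.
have [E fE] := box_kill_vars A f; exists (maxn D E) => g /predU1P[->|/fsD].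
  by apply: boxS fE; rewrite leq_maxr.
by apply: boxS; rewrite leq_maxl.
Qed.

Lemma box_power_prod A D N (fs : seq S) (t : seq nat) :
    {in fs, forall f, box A D (kill_vars A f)} -> {in t, forall j, (j <= N)%N} ->
  box A (size fs * (N * D)) (kill_vars A (power_prod fs t)).
Proof.
elim: fs t => [|f fs IHfs] t fsD tN.
  by rewrite /power_prod; case: t {tN} => [|j t]; rewrite big_nil rmorph1; apply: box1.
case: t tN => [|j t] tN; first by rewrite /power_prod big_nil rmorph1; apply: box1.
rewrite /power_prod /= big_cons rmorphM rmorphXn mulSn /=; apply: boxM.
  apply: (@boxS _ (j * D)); last exact: boxX (fsD f (mem_head _ _)).
  by rewrite leq_mul2r (tN j (mem_head _ _)) orbT.
by apply: IHfs => [g gfs | i it]; [apply: fsD | apply: tN]; rewrite inE ?gfs ?it orbT.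
Qed.

(** With D bounding the exponents of the f_i modulo the variables of A, the N^e
products lie in a box with at most (e N D + 1)^d <= N^d (e D + 1)^d monomials.
This is less than N^(d+1) for N = (e D + 1)^d + 1. *)
Lemma nzd_chain_size A (J : nat -> S -> Prop) fs :
  (forall p, var_ideal A p -> J 0%N p) -> nzd_chain J fs -> (size fs <= #|~: A|)%N.
Proof.
move=> AJ chJ; rewrite leqNgt; apply/negP=> lt_d.
set d := #|~: A| in lt_d; set e := size fs in lt_d.
have [D fsD] := box_kill_vars_seq A fs.
(* The least N with (e D + 1)^d < N. *)
pose N := ((e * D).+1 ^ d).+1.
pose g (t : e.-tuple 'I_N) := power_prod fs (map val t).
have [||c sumc0 [t c_neq0]] :=
    @more_polys_than_monomials _ (kill_vars A \o g) (box_monomials A (e * (N * D))).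
- move=> t; apply: box_msupp; apply: box_power_prod => // j /mapP[i _ ->].
  exact/ltnW/ltn_ord.
- rewrite size_box_monomials card_tuple card_ord -/d.
  have le1 : ((e * (N * D)).+1 <= N * (e * D).+1)%N.
    by rewrite mulnCA mulnS -add1n leq_add2r.
  apply: (@leq_trans (N ^ d.+1)); last by rewrite leq_pexp2l.
  apply: (@leq_ltn_trans ((N * (e * D).+1) ^ d)); first by case: (d) => // d'; rewrite leq_exp2r.
  by rewrite expnMn expnSr ltn_pmul2l ?expn_gt0.
case/negP: c_neq0; apply/eqP.
apply: (nzd_chain_independent _ chJ) => //; apply: AJ.
rewrite /var_ideal raddf_sum -[RHS]sumc0; apply: eq_bigr => i _.
by rewrite /= linearZ.
Qed.

End Independence.

(** * Dimension and depth *)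

Section CohenMacaulay.

Variables (F : fieldType) (n : nat).
Local Notation S := {mpoly F[n]}.
Implicit Types (A : {set 'I_n}) (I : S -> Prop).

Definition var_tower A (i : nat) : {set 'I_n} :=
  A :|: [set:: take i (enum (~: A))].

Lemma mem_var_tower_nth A i v0 :
  (i < #|~: A|)%N -> nth v0 (enum (~: A)) i \notin var_tower A i.
Proof.
move=> lt_i; have lt_i' : (i < size (enum (~: A)))%N by rewrite -cardE.
have : nth v0 (enum (~: A)) i \in enum (~: A) by rewrite mem_nth.
rewrite !inE mem_enum inE => /negbTE->.
have := enum_uniq (mem (~: A)); rewrite -{1}(cat_take_drop i.+1 (enum _)).
rewrite (take_nth v0 lt_i') cat_uniq rcons_uniq.
by case/andP=> /andP[].
Qed.

Lemma var_towerS A i v0 :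
  (i < #|~: A|)%N -> var_tower A i.+1 = nth v0 (enum (~: A)) i |: var_tower A i.
Proof.
move=> lt_i; have lt_i' : (i < size (enum (~: A)))%N by rewrite -cardE.
apply/setP=> u; rewrite !inE (take_nth v0 lt_i') mem_rcons inE.
by rewrite orbCA.
Qed.

Lemma krull_dim_var_ideal I A :
  (forall p, I p <-> var_ideal A p) -> krull_dim_quotient I #|~: A|.
Proof.
move=> defI; split.
  exists (fun i => var_ideal (var_tower A i)); split=> [i _ | i lt_i].
    split; first exact: var_ideal_prime.
    by move=> p /defI; apply: var_idealS; rewrite subsetUl.
  have v0 : 'I_n by case: (enum (~: A)) (cardE (~: A)) lt_i => [->|].
  split=> [p|]; first by rewrite (var_towerS v0) //; apply: var_idealS; rewrite subsetU1.
  exists 'X_(nth v0 (enum (~: A)) i); split.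
    by rewrite (var_towerS v0) //; apply: var_ideal_var; rewrite setU11.
  exact/var_notin_var_ideal/mem_var_tower_nth.
move=> e Q prQ; have [fs <- chQ] := prime_chain_nzd_chain prQ.
apply: nzd_chain_size chQ => p /defI Ip; have [prQi _] := prQ.
by have [_] := prQi 0%N isT; apply.
Qed.

Lemma ideal_add_vars I A s :
  (forall p, I p <-> var_ideal A p) ->
  forall p, ideal_add_seq I [seq 'X_v | v <- s] p <-> var_ideal (A :|: [set:: s]) p.
Proof.
move=> defI p; have idU := @var_ideal_is_ideal F n (A :|: [set:: s]).
split; [apply: ideal_gen_sub | apply: var_ideal_sub] => //.
- move=> q [/defI|/mapP[v vs ->]]; first by apply: var_idealS; rewrite subsetUl.
  by apply: var_ideal_var; rewrite !inE vs orbT.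
- exact: ideal_gen_is_ideal.
move=> u; rewrite !inE => /orP[uA|us]; apply: ideal_gen_mem.
  by left; apply/defI/var_ideal_var.
by right; apply: map_f.
Qed.

Lemma depth_var_ideal I A :
  (forall p, I p <-> var_ideal A p) -> depth_quotient I #|~: A|.
Proof.
move=> defI; split; last first.
  move=> s _ /regular_seq_nzd_chain chs; apply: nzd_chain_size chs => p /defI Ip.
  by apply: ideal_gen_mem; left.
pose s : seq S := [seq 'X_v | v <- enum (~: A)].
have szs : size s = #|~: A| by rewrite size_map -cardE.
have defIs i p : ideal_add_seq I (take i s) p <-> var_ideal (var_tower A i) p.
  by rewrite -map_take; apply: ideal_add_vars.
exists s; split=> //.
  apply/allP=> _ /mapP[v _ ->].
  by rewrite /in_irrelevant_ideal mcoeffX -mdeg_eq0 mdeg1.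
split=> [i lt_i a|].
  have v0 : 'I_n.
    by move: lt_i; rewrite /s size_map; case: (enum (~: A)).
  rewrite (nth_map v0) -?(size_map (fun v => 'X_v : S)) // !defIs.
  by apply: var_ideal_nzd; rewrite mem_var_tower_nth -?szs.
rewrite -[s]take_size => /defIs.
by have [_] := @var_ideal_prime F n (var_tower A (size s)).
Qed.

End CohenMacaulay.

(** * Independent sets of the path *)

Section PathGraph.

Variable k : nat.
Let n := (2 * k - 1)%N.

Definition even_vertices : {set 'I_n} := [set i : 'I_n | ~~ odd i].

(** For h = floor(i/2) or ceil(i/2), the fibres of h consist of adjacent
vertices, so that an independent set meets each of them at most once. *)
Lemma half_inj_independent (h : nat -> nat) (M : {set 'I_n}) :
    (forall i j, h i = h j -> i <= j -> j <= i.+1)%N ->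
  independent (path_graph n) M -> {in M &, injective (h \o val)}.
Proof.
move=> hP indM i j iM jM /= hij; apply/val_inj => /=.
wlog le_ij : i j iM jM hij / (i <= j)%N.
  by move=> IH; case/orP: (leq_total i j) => le_ij; [apply: IH | apply/esym/IH].
have le_ji := hP _ _ hij le_ij.
move/forall_inP/(_ i iM)/forall_inP/(_ j jM): indM.
rewrite /= /path_adj negb_or => /andP[neq _].
by apply/eqP; rewrite eqn_leq le_ij -ltnS ltn_neqAle le_ji eq_sym neq.
Qed.

Lemma half_step i j : (i./2 = j./2 -> i <= j -> j <= i.+1)%N.
Proof. lia. Qed.

Lemma uphalf_step i j : (uphalf i = uphalf j -> i <= j -> j <= i.+1)%N.
Proof. lia. Qed.

Lemma sum_bijective_values (h : nat -> nat) (M : {set 'I_n}) :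
    #|M| = k -> (forall i : 'I_n, h i < k)%N -> {in M &, injective (h \o val)} ->
  (\sum_(i in M) h i = \sum_(j < k) j)%N.
Proof.
move=> cM ltk inj_h; pose h' (i : 'I_n) : 'I_k := Ordinal (ltk i).
have inj_h' : {in M &, injective h'} by move=> i j iM jM [/inj_h]; apply.
have h'M : h' @: M = setT.
  by apply/eqP; rewrite eqEcard subsetT cardsT card_ord card_in_imset ?cM /=.
transitivity (\sum_(j in h' @: M) j)%N; first by rewrite big_imset.
by rewrite h'M; apply: eq_bigl => j; rewrite inE.
Qed.

Lemma even_vertices_independent : independent (path_graph n) even_vertices.
Proof.
apply/forall_inP=> i; rewrite inE => ev_i; apply/forall_inP=> j; rewrite inE => ev_j.
rewrite /= /path_adj negb_or; apply/andP; split; apply/eqP=> ij.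
  by rewrite -ij /= ev_i in ev_j.
by rewrite -ij /= ev_j in ev_i.
Qed.

Lemma card_even_vertices : #|even_vertices| = k.
Proof.
have lt_double (j : 'I_k) : (j.*2 < n)%N by have := ltn_ord j; rewrite /n; lia.
have <- : [set Ordinal (lt_double j) | j : 'I_k] = even_vertices.
  apply/setP=> i; rewrite inE; apply/imsetP/idP=> [[j _ ->]|ev_i] /=.
    by rewrite odd_double.
  have lt_i : (i./2 < k)%N by have := ltn_ord i; rewrite /n; lia.
  by exists (Ordinal lt_i) => //; apply/val_inj; rewrite /= even_halfK.
by rewrite card_imset ?card_ord // => i j [/double_inj/val_inj].
Qed.

(** M maps bijectively to {0, ..., k-1} by both roundings of i/2, so these have
equal sums over M, which forces them to agree on every element of M. *)
Lemma independent_path_unique (M : {set 'I_n}) :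
  independent (path_graph n) M -> #|M| = k -> M = even_vertices.
Proof.
move=> indM cM.
have half_lt (i : 'I_n) : (i./2 < k)%N by have := ltn_ord i; lia.
have uphalf_lt (i : 'I_n) : (uphalf i < k)%N by have := ltn_ord i; lia.
have sum_half := sum_bijective_values cM half_lt
  (half_inj_independent half_step indM).
have sum_uphalf := sum_bijective_values cM uphalf_lt
  (half_inj_independent uphalf_step indM).
have le_half (i : 'I_n) : (i \in M) ->
    (i./2 <= uphalf i ?= iff ~~ odd i)%N.
  move=> _; split; first by rewrite uphalf_half leq_addl.
  by rewrite uphalf_half -{1}[i./2]add0n eqn_add2r; case: odd.
have /esym := eq_leqif (leqif_sum le_half).
rewrite sum_half sum_uphalf eqxx => /forall_inP evM.
apply/eqP; rewrite eqEcard card_even_vertices cM leqnn andbT.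
by apply/subsetP=> i /evM; rewrite inE.
Qed.

Lemma total_cut_path_faces (A : {set 'I_n}) :
  (A \in total_cut_complex k (path_graph n)) = (A \subset ~: even_vertices).
Proof.
rewrite inE; apply/existsP/idP=> [[M /and3P[indM /eqP cM]]|sA].
  by rewrite (independent_path_unique indM cM).
exists even_vertices.
by rewrite even_vertices_independent card_even_vertices eqxx.
Qed.

End PathGraph.

(** The nonfaces are the sets that meet M; the minimal ones are the points
of M. *)
Lemma stanley_reisner_var_ideal (F : fieldType) n
    (D : simplicial_complex 'I_n) (M : {set 'I_n}) :
  (forall A : {set 'I_n}, (A \in D) = (A \subset ~: M)) ->
  forall p, stanley_reisner_ideal F D p <-> var_ideal M p.
Proof.
move=> facesD p; have idM := @var_ideal_is_ideal F n M.
split; [apply: ideal_gen_sub | apply: var_ideal_sub] => //.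
- move=> _ [A [AD ->]]; move: AD; rewrite facesD => /subsetPn[u uA].
  rewrite inE negbK (bigD1 u) //= mulrC => uM.
  by apply: idealM => //; apply: var_ideal_var.
- exact: ideal_gen_is_ideal.
move=> u uM; apply: ideal_gen_mem; exists [set u].
by rewrite facesD sub1set inE uM big_set1.
Qed.

Theorem theorem22 (F : fieldType) (k : nat) (hk : (2 < k)%N) :
  has_linear_resolution
    (stanley_reisner_ideal F (total_cut_complex k (path_graph (2 * k - 1)))) /\
  cohen_macaulay_quotient
    (stanley_reisner_ideal F (total_cut_complex k (path_graph (2 * k - 1)))).
Proof.
have defI := @stanley_reisner_var_ideal F _ _ _ (@total_cut_path_faces k).
split; first exact: var_ideal_has_linear_resolution defI.
by exists #|~: even_vertices k|; split; [apply: depth_var_ideal | apply: krull_dim_var_ideal].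
Qed.
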